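(* Let $L$ be a loop of order $n$ with underlying set $I_n=\{1,2,\ldots,n\}$, whose product of $x$ and $y$ is written $xy$, and let $c$ be any non-identity element of $L$. Let $\Gamma_4$ be the digraph with vertex set $I_n\times I_n\times\mathbb{Z}_3$ whose darts (arcs) are exactly the following: \begin{itemize} \item $(x,y,i)\mapsto(z,y,i)$ for all $i\in\mathbb{Z}_3$, $x,y,z\in I_n$, $x\neq z$; \item $(x,y,i)\mapsto(x,z,i)$ for all $i\in\mathbb{Z}_3$, $x,y,z\in I_n$, $y\neq z$; \item $(x,y,i)\mapsto(xy,z,i+1)$ for all $i\in\mathbb{Z}_3$, $x,y,z\in I_n$; \item $(x,y,i)\mapsto(z,yx,i-1)$ for all $i\in\mathbb{Z}_3$, $x,y,z\in I_n$; \item $(x,y,i)\mapsto(c(xy),z,i+1)$ for all $i\in\mathbb{Z}_3$, $x,y,z\in I_n$; \item $(x,y,i)\mapsto(z,(yx)c,i-1)$ for all $i\in\mathbb{Z}_3$, $x,y,z\in I_n$. \end{itemize} Then $\Gamma_4$ is a directed strongly regular graph with parameter set $(3n^2,\,6n-2,\,2n+6,\,n+6,\,10)$.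
   Context: A quasigroup is a set $Q$ with a binary operation such that for all $a,b\in Q$ each of the equations $ax=b$ and $ya=b$ has a unique solution in $Q$. A loop is a quasigroup with an identity element $e$, i.e. $ex=xe=x$ for every $x$. Associativity is not assumed. A directed strongly regular graph (DSRG) with parameter set $(N,k,t,\lambda,\mu)$ (in this order) is a loopless directed graph on $N$ vertices that is regular of valency $k$ (every vertex has in-degree and out-degree $k$), such that every vertex is incident with exactly $t$ undirected edges (an undirected edge is a pair of opposite arcs), and for any two distinct vertices $x,y$ the number of directed paths of length 2 from $x$ to $y$ is $\lambda$ if there is an arc from $x$ to $y$ and $\mu$ otherwise. Equivalently, its adjacency matrix $A$ (with zero diagonal) satisfies $AJ=JA=kJ$ and $A^2=tI+\lambda A+\mu(J-I-A)$, where $J$ is the all-one matrix and $I$ the identity matrix. The case $t=k$ (an undirected strongly regular graph) is allowed in this definition. *)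

(* Defs.v *)
From HB Require Import structures.
From mathcomp Require Import all_boot all_order all_algebra.

Set Implicit Arguments.
Unset Strict Implicit.
Unset Printing Implicit Defensive.

Import GRing.Theory.

Definition is_quasigroup (Q : Type) (op : Q -> Q -> Q) : Prop :=
  (forall a b : Q, exists! x, op a x = b) /\
  (forall a b : Q, exists! y, op y a = b).

Definition is_loop (Q : Type) (op : Q -> Q -> Q) (e : Q) : Prop :=
  [/\ is_quasigroup op, left_id e op & right_id e op].

(* A digraph on T is given by its arc relation.  An undirected edge at x is
   counted through its other endpoint.  A path of length 2 from x to y is
   counted through its middle vertex, which differs from x and y because there
   are no loops.  The case t = k is allowed. *)
Definition is_dsrg (T : finType) (arc : rel T) (N k t lambda mu : nat) : Prop :=
  #|T| = N /\
  (forall x, ~~ arc x x) /\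
  (forall x, #|[set y | arc x y]| = k) /\
  (forall x, #|[set y | arc y x]| = k) /\
  (forall x, #|[set y | arc x y && arc y x]| = t) /\
  (forall x y, x != y ->
     #|[set z | arc x z && arc z y]| = if arc x y then lambda else mu).

(* The index set {1, ..., n} is represented by 'I_n = {0, ..., n-1}. *)
Definition Gamma4 (n : nat) (op : 'I_n -> 'I_n -> 'I_n) (c : 'I_n) :
    rel ('I_n * 'I_n * 'Z_3) :=
  fun u v =>
    let: (x, y, i) := u in
    let: (x', y', j) := v in
    [|| [&& x != x', y' == y & j == i],
        [&& x' == x, y != y' & j == i],
        (x' == op x y) && (j == i + 1)%R,
        (y' == op y x) && (j == i - 1)%R,
        (x' == op c (op x y)) && (j == i + 1)%R
      | (y' == op (op y x) c) && (j == i - 1)%R].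

(* Main.v *)
(* Up to the rook graph on each of the three layers, an arc from (x, y, i) to
   (x', y', j) is governed by a ternary relation: [p x y x'] when j = i + 1 and
   [q y x y'] when j = i - 1.  The quasigroup axioms, and the absence of fixed
   points of the translations by c, ensure that both relations have all their
   line sums equal to 2.  This alone determines the number of paths of
   length 2, counted layer by layer; the two non-adjacent counts 2 + 2 * 2 ^ 2
   (within a layer) and 3 * 2 + 2 ^ 2 (between layers) agree. *)
Require Import Defs.
From mathcomp Require Import all_boot all_order all_algebra.
From mathcomp Require Import zify.

Set Implicit Arguments.
Unset Strict Implicit.
Unset Printing Implicit Defensive.

Import GRing.Theory.

(** * Line sums and counting by indicator functions *)

Section LineSums.

Variables (T : finType) (n : nat).
Hypothesis cardT : #|T| = n.

(** The model case is the union of two disjoint Latin squares, seen as sets of triples. *)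
Definition line_sums2 (p : T -> T -> T -> bool) : Prop :=
  [/\ forall y z, \sum_x p x y z = 2,
      forall x z, \sum_y p x y z = 2 &
      forall x y, \sum_z p x y z = 2].

Lemma card_set_sum (U : finType) (P : pred U) : #|[set u | P u]| = \sum_u P u.
Proof.
by rewrite -sum1dep_card big_mkcond; apply: eq_bigr => u _; case: (P u).
Qed.

Lemma sum_eq_op (a : T) : \sum_x (x == a) = 1.
Proof. by rewrite (bigD1 a) //= eqxx big1 // => x /negbTE->. Qed.

Lemma sum_neq (F : T -> bool) (a : T) m :
  \sum_x F x = m -> \sum_(x | x != a) F x = m - F a.
Proof. by move=> <-; rewrite [in RHS](bigD1 a) //= addKn. Qed.

Lemma sum_const_card m : \sum_(x : T) m = n * m.
Proof. by rewrite sum_nat_const -cardT. Qed.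

Lemma sum_neq_const (a : T) m : \sum_(x | x != a) m = n.-1 * m.
Proof. by rewrite sum_nat_const -cardT -(cardC1 a). Qed.

Lemma sum_path (A : T -> bool) (B : T -> T -> bool) k m :
    \sum_a A a = k -> (forall a, \sum_b B a b = m) ->
  \sum_a \sum_b (A a && B a b) = k * m.
Proof.
move=> sumA sumB; rewrite -sumA big_distrl; apply: eq_bigr => a _ /=.
by rewrite -(sumB a) big_distrr; apply: eq_bigr => b _ /=; rewrite mulnb.
Qed.

Lemma sum_path_exchange (A : T -> bool) (B : T -> T -> bool) k m :
    \sum_a A a = k -> (forall a, \sum_b B b a = m) ->
  \sum_b \sum_a (A a && B b a) = k * m.
Proof. by move=> sumA sumB; rewrite exchange_big; apply: sum_path. Qed.

(** * The rook graph on one layer *)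

Definition rook (x y x' y' : T) : bool :=
  (x' != x) && (y' == y) || (x' == x) && (y' != y).

Lemma rook_sym x y x' y' : rook x y x' y' = rook x' y' x y.
Proof. by rewrite /rook (eq_sym x) (eq_sym y). Qed.

Lemma sum_rook (F : T -> T -> bool) x y :
  \sum_u \sum_v (rook x y u v && F u v) =
  \sum_(u | u != x) F u y + \sum_(v | v != y) F x v.
Proof.
rewrite (bigD1 x) //= addnC; congr (_ + _); last first.
  rewrite [RHS]big_mkcond; apply: eq_bigr => v _.
  by rewrite /rook eqxx /=; case: (v == y).
apply: eq_bigr => u neq_ux; rewrite (bigD1 y) //= big1 => [|v neq_vy].
  by rewrite addn0 /rook neq_ux eqxx.
by rewrite /rook (negbTE neq_ux) (negbTE neq_vy).
Qed.

Lemma rook_degree x y : \sum_u \sum_v rook x y u v = n.-1 + n.-1.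
Proof.
under eq_bigr do under eq_bigr do rewrite -[rook _ _ _ _]andbT.
by rewrite sum_rook !sum_neq_const !muln1.
Qed.

(** Two vertices on a common line are joined through the other [n - 2] vertices of that line;
    otherwise through the two remaining corners of the rectangle they span. *)
Lemma rook_paths x y x' y' : (x, y) != (x', y') ->
  \sum_u \sum_v (rook x y u v && rook u v x' y') =
  if rook x y x' y' then n - 2 else 2.
Proof.
have sum_ne (a b : T) : b != a -> \sum_(u | u != a) (u != b) = n - 2.
  move=> neq_ba.
  rewrite (@sum_neq _ _ n.-1) ?(eq_sym a) ?neq_ba ?subn1 ?subn2 //.
  rewrite -[RHS]muln1 -(sum_neq_const b) [RHS]big_mkcond.
  by apply: eq_bigr => u _; case: (u == b).
have sum_eq (a b : T) : b != a -> \sum_(u | u != a) (u == b) = 1.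
  by move=> neq_ba; rewrite (sum_neq _ (sum_eq_op b)) eq_sym (negbTE neq_ba).
rewrite sum_rook xpair_eqE /rook (eq_sym x) (eq_sym y).
have [->|neq_x] := eqVneq x' x; have [->|neq_y] //= := eqVneq y' y => _.
- rewrite big1 => [|u /negbTE neq_ux]; last by rewrite andbF andbT eq_sym neq_ux.
  by under eq_bigr do rewrite eq_sym; exact: sum_ne.
- rewrite [X in _ + X]big1 => [|v /negbTE neq_vy]; last first.
    by rewrite orbF eq_sym neq_vy.
  under eq_bigr do rewrite andbF andbT orbF eq_sym.
  by rewrite addn0 sum_ne.
under eq_bigr do rewrite andbF andbT orFb eq_sym.
under [X in _ + X]eq_bigr do rewrite orbF eq_sym.
by rewrite !sum_eq.
Qed.

(** * Three rook layers joined by ternary relations *)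

Variables p q : T -> T -> T -> bool.

(** In ['Z_3] the last branch means [j = i - 1]. The order [y], [x] in [q] matches the products
    [yx]. *)
Definition layered (u v : T * T * 'Z_3) : bool :=
  let: (x, y, i) := u in
  let: (x', y', j) := v in
  if j == i then rook x y x' y'
  else if j == (i + 1)%R then p x y x' else q y x y'.

Lemma Z3_ind (P : 'Z_3 -> Prop) :
  P 0%R -> P 1%R -> P (-1)%R -> forall i, P i.
Proof.
move=> P0 P1 P2 [[|[|[|//]]] lti].
- by rewrite (_ : Ordinal lti = 0%R) //; apply: val_inj.
- by rewrite (_ : Ordinal lti = 1%R) //; apply: val_inj.
by rewrite (_ : Ordinal lti = (-1)%R) //; apply: val_inj.
Qed.

Lemma Z3_offset (P : 'Z_3 -> Prop) i :
  P i -> P (i + 1)%R -> P (i - 1)%R -> forall j, P j.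
Proof.
move=> P0 P1 P2 j; rewrite -[j](subrK i) addrC.
by elim/Z3_ind: (j - i)%R; rewrite ?addr0.
Qed.

Lemma sum_Z3 (F : 'Z_3 -> nat) i :
  \sum_j F j = F i + F (i + 1)%R + F (i - 1)%R.
Proof.
rewrite !big_ord_recl big_ord0 addn0 addnA.
(* The three values of [i] give the cyclic rotations of one sum. *)
by elim/Z3_ind: i; [| rewrite -addnA addnC | rewrite addnC addnA];
  congr (F _ + F _ + F _); apply: val_inj.
Qed.

(** Layers are listed relative to [i] so that [layeredE] can turn each summand into [rook], [p] or
    [q]. *)
Lemma card_layers (P : pred (T * T * 'Z_3)) i :
  #|[set u | P u]| = \sum_x \sum_y P (x, y, i)
                   + \sum_x \sum_y P (x, y, i + 1)%R
                   + \sum_x \sum_y P (x, y, i - 1)%R.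
Proof.
rewrite card_set_sum -!big_split /=.
transitivity (\sum_s \sum_j P (s, j)).
  by rewrite pair_bigA; apply: eq_bigr => -[].
under [RHS]eq_bigr do rewrite -!big_split /=.
rewrite [RHS]pair_bigA; apply: eq_bigr => -[x y] _.
by rewrite (sum_Z3 _ i).
Qed.

Lemma layered0 x y x' y' i : layered (x, y, i) (x', y', i) = rook x y x' y'.
Proof. by rewrite /layered eqxx. Qed.

Lemma layered_up x y x' y' i :
  layered (x, y, i) (x', y', i + 1)%R = p x y x'.
Proof. by rewrite /layered; elim/Z3_ind: i. Qed.

Lemma layered_down x y x' y' i :
  layered (x, y, i) (x', y', i - 1)%R = q y x y'.
Proof. by rewrite /layered; elim/Z3_ind: i. Qed.

Lemma layered_from_up x y x' y' i :
  layered (x, y, i + 1)%R (x', y', i) = q y x y'.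
Proof. by rewrite /layered; elim/Z3_ind: i. Qed.

Lemma layered_from_down x y x' y' i :
  layered (x, y, i - 1)%R (x', y', i) = p x y x'.
Proof. by rewrite /layered; elim/Z3_ind: i. Qed.

(** Modulo 3, passing from [i + 1] to [i - 1] is a step by [+1]. *)
Lemma layered_up_down x y x' y' i :
  layered (x, y, i + 1)%R (x', y', i - 1)%R = p x y x'.
Proof. by rewrite /layered; elim/Z3_ind: i. Qed.

Lemma layered_down_up x y x' y' i :
  layered (x, y, i - 1)%R (x', y', i + 1)%R = q y x y'.
Proof. by rewrite /layered; elim/Z3_ind: i. Qed.

Definition layeredE := (layered0, layered_up, layered_down, layered_from_up,
  layered_from_down, layered_up_down, layered_down_up).

Hypotheses (p2 : line_sums2 p) (q2 : line_sums2 q).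

Lemma layered_dsrg :
  is_dsrg layered (3 * n ^ 2) (6 * n - 2) (2 * n + 6) (n + 6) 10.
Proof.
have [px py pz] := p2; have [qx qy qz] := q2.
split; first by rewrite !card_prod card_ord cardT mulnC -mulnn.
split; first by move=> [[x y] i]; rewrite layeredE /rook !eqxx.
(* Any vertex makes [n] positive, so [n.-1] is a true subtraction. *)
have card_gt0 (x : T) : 0 < n by rewrite -cardT; apply/card_gt0P; exists x.
split.
  move=> [[x y] i]; have T0 := card_gt0 x; rewrite (card_layers _ i).
  under eq_bigr do under eq_bigr do rewrite !layeredE.
  under [X in _ + X + _]eq_bigr do under eq_bigr do rewrite !layeredE.
  under [X in _ + X]eq_bigr do under eq_bigr do rewrite !layeredE.
  rewrite rook_degree [X in _ + X + _]exchange_big /=.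
  under [X in _ + X + _]eq_bigr do rewrite pz.
  under [X in _ + X]eq_bigr do rewrite qz.
  by rewrite !sum_const_card; lia.
split.
  move=> [[x y] i]; have T0 := card_gt0 x; rewrite (card_layers _ i).
  under eq_bigr do under eq_bigr do rewrite !layeredE.
  under [X in _ + X + _]eq_bigr do under eq_bigr do rewrite !layeredE.
  under [X in _ + X]eq_bigr do under eq_bigr do rewrite !layeredE.
  under eq_bigr do under eq_bigr do rewrite rook_sym.
  rewrite rook_degree.
  under [X in _ + X + _]eq_bigr do rewrite qx.
  under [X in _ + X]eq_bigr do rewrite py.
  by rewrite !sum_const_card; lia.
split.
  move=> [[x y] i]; have T0 := card_gt0 x; rewrite (card_layers _ i).
  under eq_bigr do under eq_bigr do rewrite !layeredE.
  under [X in _ + X + _]eq_bigr do under eq_bigr do rewrite !layeredE.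
  under [X in _ + X]eq_bigr do under eq_bigr do rewrite !layeredE.
  under eq_bigr do under eq_bigr do rewrite rook_sym andbb rook_sym.
  (* Each of the two other layers contributes [2 * 2] undirected edges: the outgoing arc leaves two
     values for one coordinate, and the returning arc then leaves two for the other. *)
  rewrite rook_degree (sum_path (pz x y) (fun a => qx a y)).
  rewrite (sum_path_exchange (qz y x) (fun b => px b x)).
  lia.
move=> [[x y] i] [[x' y'] j].
move: j; apply: (Z3_offset (i := i)) => neq; rewrite (card_layers _ i);
  under eq_bigr do under eq_bigr do rewrite !layeredE;
  under [X in _ + X + _]eq_bigr do under eq_bigr do rewrite !layeredE;
  under [X in _ + X]eq_bigr do under eq_bigr do rewrite !layeredE.
- rewrite layeredE rook_paths; last by apply: contraNneq neq => -[-> ->].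
  rewrite (sum_path (pz x y) (fun a => qx a y')).
  rewrite (sum_path_exchange (qz y x) (fun b => px b x')).
  case: ifP => //; rewrite /rook => adj.
  (* Here [(n - 2) + 4 + 4 = n + 6] requires [n - 2] not to be truncated; the adjacent vertices
     supply two distinct elements. *)
  have: 1 < n.
    rewrite -cardT; apply/card_gt1P.
    case/orP: adj => /andP[]; [move=> ne _ | move=> _ ne].
      by exists x', x.
    by exists y', y.
  lia.
(* Let [d] be [p x y x'] as 0 or 1. Layers [i], [i + 1], [i - 1] carry [2(2 - d)],
   [(2 - d) + (n - 1)d] and 4 middle vertices, in all [10 + (n - 4)d]. *)
- rewrite sum_rook (sum_neq _ (px y x')) (sum_neq _ (py x x')).
  under [X in _ + X + _]eq_bigr do under eq_bigr do rewrite andbC rook_sym.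
  rewrite sum_rook (sum_neq _ (pz x y)) sum_neq_const.
  rewrite (sum_path_exchange (qz y x) (fun b => qy b y')) layeredE.
  by have := card_gt0 x; case: (p x y x'); lia.
rewrite sum_rook (sum_neq _ (qy y y')) (sum_neq _ (qx x y')).
under [X in _ + X]eq_bigr do under eq_bigr do rewrite andbC rook_sym.
rewrite sum_rook (sum_neq _ (qz y x)) sum_neq_const.
rewrite (sum_path (pz x y) (fun a => py a x')) layeredE.
by have := card_gt0 x; case: (q y x y'); lia.
Qed.

End LineSums.

(** * From loops to line sums *)

Lemma sum_exists_unique (T : finType) (F : T -> bool) :
  (exists! x, F x) -> \sum_x F x = 1.
Proof.
case=> a [Fa uniq_a]; rewrite -(sum_eq_op a); apply: eq_bigr => x _.
by congr nat_of_bool; apply/idP/eqP => [/uniq_a|->].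
Qed.

(** Composing [op] with the bijection [f] gives another quasigroup operation, and the graph of
    either has line sums 1. As [f] has no fixed point, the two graphs are disjoint and the sums
    add. *)
Lemma quasigroup_line_sums2 (T : finType) (op : T -> T -> T) (f : T -> T) :
    is_quasigroup op -> (forall b, exists! a, f a = b) ->
    (forall a, f a <> a) ->
  line_sums2 (fun x y z => (z == op x y) || (z == f (op x y))).
Proof.
move=> [divl divr] f_bij f_nofix.
have sum_sol (h : T -> T) z : (exists! x, h x = z) -> \sum_x (z == h x) = 1.
  case=> a [ha uniq_a]; apply: sum_exists_unique; exists a.
  by split=> [|x /eqP/esym/uniq_a //]; rewrite ha.
have f_comp (h : T -> T) z :
    (forall b, exists! x, h x = b) -> exists! x, f (h x) = z.
  move=> h_bij; have [b [fb uniq_b]] := f_bij z.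
  have [a [ha uniq_a]] := h_bij b; exists a; split; first by rewrite ha.
  by move=> x /uniq_b/esym/uniq_a.
have orE z w : ((z == w) || (z == f w) : nat) = (z == w) + (z == f w).
  by have [->|//] := eqVneq z w; case: eqP => // /esym/f_nofix.
split=> a b; under eq_bigr do rewrite orE; rewrite big_split /=.
- by rewrite !sum_sol //; apply: f_comp => ?; apply: divr.
- by rewrite !sum_sol //; apply: f_comp => ?; apply: divl.
by rewrite !sum_eq_op.
Qed.

Lemma is_dsrg_ext (T : finType) (arc arc' : rel T) N k t lambda mu :
  arc =2 arc' -> is_dsrg arc N k t lambda mu -> is_dsrg arc' N k t lambda mu.
Proof.
move=> eq_arc [cardT [irr [outd [ind [undir paths]]]]].
split=> //; split=> [x|]; first by rewrite -eq_arc.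
split=> [x|]; first by rewrite -(outd x); apply: eq_card => y; rewrite !inE eq_arc.
split=> [x|]; first by rewrite -(ind x); apply: eq_card => y; rewrite !inE eq_arc.
split=> [x|x y neq]; last rewrite -eq_arc -(paths x y neq).
  by rewrite -(undir x); apply: eq_card => y; rewrite !inE !eq_arc.
by apply: eq_card => z; rewrite !inE !eq_arc.
Qed.

Theorem theorem5p2 (n : nat) (op : 'I_n -> 'I_n -> 'I_n) (e c : 'I_n)
    (loop_op : is_loop op e) (c_neq_e : c <> e) :
  is_dsrg (Gamma4 op c) (3 * n ^ 2) (6 * n - 2) (2 * n + 6) (n + 6) 10.
Proof.
have [quasi op1l op1r] := loop_op; have [divl divr] := quasi.
(* Both [c] and [e] would solve [y a = a], against uniqueness. *)
have left_nofix a : op c a <> a.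
  have [b [_ uniq_b]] := divr a a.
  by move=> /uniq_b eq_bc; apply: c_neq_e; rewrite -eq_bc; apply: uniq_b.
have right_nofix a : op a c <> a.
  have [b [_ uniq_b]] := divl a a.
  by move=> /uniq_b eq_bc; apply: c_neq_e; rewrite -eq_bc; apply: uniq_b.
(* The bijection [f] is left translation by [c] for [p] and right translation by [c] for [q]. *)
have := layered_dsrg (card_ord n) (quasigroup_line_sums2 quasi (divl c) left_nofix)
  (quasigroup_line_sums2 quasi (divr c) right_nofix).
apply: is_dsrg_ext => -[[x y] i] [[x' y'] j].
rewrite /= /rook (eq_sym x) (eq_sym y).
(* Since [i], [i + 1] and [i - 1] are distinct, exactly two of the six arc families survive for each
   position of [j]. *)
move: j; apply: (Z3_offset (i := i)); rewrite ?eqxx.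
- have [-> ->] : (i == i + 1)%R = false /\ (i == i - 1)%R = false.
    by elim/Z3_ind: i.
  by rewrite !andbF !andbT !orbF.
- have [-> ->] : (i + 1 == i)%R = false /\ (i + 1 == i - 1)%R = false.
    by elim/Z3_ind: i.
  by rewrite !andbF !andbT !orbF.
have [-> ->] : (i - 1 == i)%R = false /\ (i - 1 == i + 1)%R = false.
  by elim/Z3_ind: i.
by rewrite !andbF !andbT.
Qed.
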